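(* Let $(X,p_1),(Y,p_2)$ and $(Z,q)$ be asymmetric normed spaces. Let $(T_n)$ be a sequence of $q^s$-precompact bilinear operators in $\mathcal{L}^2_{p_1,p_2;q^s}(X,Y;Z)$ and let $T:X\times Y\to Z$ be a mapping. If for every $(x,y)\in X\times Y$ the sequence $(T_n(x,y))$ is $q^s$-convergent to $T(x,y)$, uniformly on $B_{p_1}\times B_{p_2}$, then $T$ is a bilinear $q^s$-precompact operator. In particular, the cone $\mathcal{K}^2_{p_1,p_2;q^s}(X,Y;Z)$ of all $q^s$-precompact bilinear operators is $d_s$-closed in $\mathcal{L}^2_{p_1,p_2;q^s}(X,Y;Z)$.
   Context: An asymmetric norm on a real vector space $X$ is a functional $p:X\to[0,\infty)$ such that $p(x)=p(-x)=0\Rightarrow x=0$, $p(\alpha x)=\alpha p(x)$ and $p(x+y)\le p(x)+p(y)$ for all $x,y\in X$, $\alpha\ge 0$. It carries the topology $\tau(p)$ of the quasi-metric $d_p(x,y)=p(y-x)$: neighborhoods of $x$ are the sets containing a ball $\{y: d_p(x,y)<r\}$, $r>0$. Put $B_p=\{x: p(x)\le 1\}$ and $p^s(x)=\max\{p(x),p(-x)\}$, which is a norm. $\mathcal{L}^2_{p_1,p_2;q^s}(X,Y;Z)$ is the set of bilinear operators $X\times Y\to Z$ that are continuous from the product of the topologies $\tau(p_1)$ and $\tau(p_2)$ to the topology of the norm $q^s$. It carries the extended metric $$d_s(T_1,T_2)=\sup\{q^s(T_2(x,y)-T_1(x,y)):(x,y)\in B_{p_1}\times B_{p_2}\}.$$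 A bilinear operator $T:X\times Y\to Z$ is $q^s$-precompact if $T(B_{p_1}\times B_{p_2})$ is a precompact (totally bounded) subset of the normed space $(Z,q^s)$. $q^s$-precompact bilinear operators automatically belong to $\mathcal{L}^2_{p_1,p_2;q^s}(X,Y;Z)$. *)

(* Defs.v *)
From HB Require Import structures.
From mathcomp Require Import all_boot all_order all_algebra.
From mathcomp Require Import all_classical all_reals all_analysis.

Set Implicit Arguments.
Unset Strict Implicit.
Unset Printing Implicit Defensive.

Import Order.TTheory GRing.Theory Num.Theory.
Import numFieldNormedType.Exports.

Local Open Scope classical_set_scope.
Local Open Scope ring_scope.

Record asymNorm (R : realType) (X : lmodType R) := AsymNorm {
  asym_norm :> X -> R;
  asym_norm_ge0 : forall x, 0 <= asym_norm x;
  asym_norm_eq0 : forall x, asym_norm x = 0 -> asym_norm (- x) = 0 -> x = 0;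
  asym_normZ : forall (a : R) x, 0 <= a -> asym_norm (a *: x) = a * asym_norm x;
  asym_normD : forall x y, asym_norm (x + y) <= asym_norm x + asym_norm y
}.

Section AsymNormTheory.
Context (R : realType) (X : lmodType R) (p : asymNorm X).

Definition asym_unit_ball : set X := [set x | p x <= 1].

Definition sym_norm (x : X) : R := Num.max (p x) (p (- x)).

Lemma asym_norm0 : p 0 = 0.
Proof. by rewrite -(scale0r (0 : X)) asym_normZ// mul0r. Qed.

Lemma sym_norm_ge0 x : 0 <= sym_norm x.
Proof. by rewrite le_max asym_norm_ge0. Qed.

Lemma sym_normD x y : sym_norm (x + y) <= sym_norm x + sym_norm y.
Proof.
rewrite ge_max; apply/andP; split.
  by apply: (le_trans (asym_normD _ _ _)); rewrite lerD// le_max lexx.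
rewrite opprD; apply: (le_trans (asym_normD _ _ _)).
by rewrite lerD// le_max lexx orbT.
Qed.

Lemma sym_normN x : sym_norm (- x) = sym_norm x.
Proof. by rewrite /sym_norm opprK maxC. Qed.

Lemma sym_normZ (a : R) x : sym_norm (a *: x) = `|a| * sym_norm x.
Proof.
wlog a0 : a / 0 <= a => [hw|].
  have [/hw//|/ltW a0] := leP 0 a.
  by rewrite -sym_normN -scaleNr hw ?oppr_ge0// normrN.
by rewrite ger0_norm// /sym_norm -scalerN !asym_normZ// maxr_pMr.
Qed.

Lemma sym_norm_eq0 x : sym_norm x = 0 -> x = 0.
Proof.
move=> x0; apply: (@asym_norm_eq0 _ _ p); apply/eqP;
  rewrite eq_le asym_norm_ge0 andbT -x0 le_max lexx ?orbT//.
Qed.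

End AsymNormTheory.

(* X with the topology tau(p) of the quasi-metric d_p(x, y) = p (y - x) *)
Definition asym_space (R : realType) (X : lmodType R) (p : asymNorm X) : Type :=
  X.

Section AsymTopology.
Context (R : realType) (X : lmodType R) (p : asymNorm X).

Definition asym_nbhs (x : asym_space p) : set_system (asym_space p) :=
  filter_from [set r : R | 0 < r]
    (fun r => [set y : X | p (y - (x : X)) < r]).

HB.instance Definition _ := Choice.copy (asym_space p) X.
HB.instance Definition _ := hasNbhs.Build (asym_space p) asym_nbhs.

Let asym_nbhs_filter (x : asym_space p) : ProperFilter (nbhs x).
Proof.
apply: filter_from_proper; last first.
  by move=> r r0; exists x; rewrite /= subrr asym_norm0.
apply: filter_from_filter; first by exists 1 => /=.
move=> r s /= r0 s0; exists (Num.min r s); first by rewrite /= lt_min r0.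
by move=> y /=; rewrite lt_min => /andP[].
Qed.

Let asym_nbhs_singleton (x : asym_space p) (A : set (asym_space p)) :
  nbhs x A -> A x.
Proof. by move=> [r /= r0]; apply; rewrite /= subrr asym_norm0. Qed.

Let asym_nbhs_nbhs (x : asym_space p) (A : set (asym_space p)) :
  nbhs x A -> nbhs x (nbhs^~ A).
Proof.
move=> [r /= r0 rA]; exists r => //= y yr.
exists (r - p ((y : X) - x)); first by rewrite /= subr_gt0.
move=> z /=; rewrite ltrBrDr => zr; apply: rA => /=; apply: le_lt_trans zr.
rewrite -[(z : X) - x](subrKA (y : X)).
exact: asym_normD.
Qed.

HB.instance Definition _ := Nbhs_isNbhsTopological.Build (asym_space p)
  asym_nbhs_filter asym_nbhs_singleton asym_nbhs_nbhs.

End AsymTopology.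

(* X normed by p^s *)
Definition sym_space (R : realType) (X : lmodType R) (p : asymNorm X) : Type :=
  X.

HB.instance Definition _ (R : realType) (X : lmodType R) (p : asymNorm X) :=
  GRing.Lmodule.copy (sym_space p) X.
HB.instance Definition _ (R : realType) (X : lmodType R) (p : asymNorm X) :=
  @Lmodule_isNormed.Build R (sym_space p) (sym_norm p)
    (sym_normD p) (sym_normZ p) (@sym_norm_eq0 R X p).

(* The library's [precompact] means relatively compact, which differs from this
   when V is not complete. *)
Definition totally_bounded (R : realType) (V : pseudoMetricType R) (A : set V) :=
  forall e : R, 0 < e ->
    exists2 F : set V, finite_set F & A `<=` \bigcup_(c in F) ball c e.

Section BilinearOperators.
Context (R : realType) (X Y Z : lmodType R).

Definition bilinear_op (T : X * Y -> Z) : Prop :=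
  (forall y, linear (fun x => T (x, y))) /\
  (forall x, linear (fun y => T (x, y))).

Context (p1 : asymNorm X) (p2 : asymNorm Y) (q : asymNorm Z).

Definition unit_balls : set (X * Y) :=
  asym_unit_ball p1 `*` asym_unit_ball p2.

Record contBilinOp := ContBilinOp {
  contBilinOp_fun :> X * Y -> Z;
  contBilinOp_bilinear : bilinear_op contBilinOp_fun;
  contBilinOp_continuous :
    continuous (contBilinOp_fun : asym_space p1 * asym_space p2 -> sym_space q)
}.

(* Continuity is not required: it follows from boundedness on the unit balls. *)
Definition precompact_bilinear_op : set (X * Y -> Z) :=
  [set T | bilinear_op T /\
    totally_bounded (T @` unit_balls : set (sym_space q))].

Definition d_s (T1 T2 : contBilinOp) : \bar R :=
  ereal_sup [set (sym_norm q (T2 xy - T1 xy))%:E | xy in unit_balls].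

Lemma d_s_ub (T1 T2 : contBilinOp) xy : unit_balls xy ->
  ((sym_norm q (T2 xy - T1 xy))%:E <= d_s T1 T2)%E.
Proof. by move=> xyB; apply: ereal_sup_ubound; exists xy. Qed.

Lemma d_s_ge0 (T1 T2 : contBilinOp) : (0 <= d_s T1 T2)%E.
Proof.
apply: (@le_trans _ _ (sym_norm q (T2 (0, 0) - T1 (0, 0)))%:E).
  by rewrite lee_fin sym_norm_ge0.
by apply: d_s_ub; split; rewrite /asym_unit_ball/= asym_norm0.
Qed.

Lemma d_sxx (T : contBilinOp) : d_s T T = 0%E.
Proof.
apply/eqP; rewrite eq_le d_s_ge0 andbT; apply: ge_ereal_sup => _ [xy _ <-].
by rewrite subrr /sym_norm oppr0 asym_norm0 maxxx.
Qed.

Lemma d_s_sym (T1 T2 : contBilinOp) : d_s T1 T2 = d_s T2 T1.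
Proof.
rewrite /d_s; congr ereal_sup; apply: eq_imagel => xy _.
by rewrite -sym_normN opprB.
Qed.

Lemma d_s_triangle (T1 T2 T3 : contBilinOp) :
  (d_s T1 T3 <= d_s T1 T2 + d_s T2 T3)%E.
Proof.
apply: ge_ereal_sup => _ [xy xyB <-].
apply: le_trans (leeD (d_s_ub T1 T2 xyB) (d_s_ub T2 T3 xyB)).
rewrite -EFinD lee_fin -[T3 xy - T1 xy](subrKA (T2 xy)).
by rewrite [leRHS]addrC sym_normD.
Qed.

HB.instance Definition _ := gen_eqMixin contBilinOp.
HB.instance Definition _ := gen_choiceMixin contBilinOp.

Definition d_s_ball (T1 : contBilinOp) (e : R) : set contBilinOp :=
  [set T2 | (d_s T1 T2 < e%:E)%E].

Let d_s_ball_center T (e : R) : 0 < e -> d_s_ball T e T.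
Proof. by move=> e0; rewrite /d_s_ball/= d_sxx lte_fin. Qed.

Let d_s_ball_sym T1 T2 (e : R) : d_s_ball T1 e T2 -> d_s_ball T2 e T1.
Proof. by rewrite /d_s_ball/= d_s_sym. Qed.

Let d_s_ball_triangle T1 T2 T3 (e1 e2 : R) :
  d_s_ball T1 e1 T2 -> d_s_ball T2 e2 T3 -> d_s_ball T1 (e1 + e2) T3.
Proof.
move=> h1 h2; rewrite /d_s_ball/= EFinD.
exact: le_lt_trans (d_s_triangle _ T2 _) (lteD h1 h2).
Qed.

HB.instance Definition _ :=
  hasNbhs.Build contBilinOp (nbhs_ (entourage_ d_s_ball)).
HB.instance Definition _ := @Nbhs_isPseudoMetric.Build R contBilinOp
  (entourage_ d_s_ball) erefl d_s_ball d_s_ball_center d_s_ball_sym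
  d_s_ball_triangle erefl.

End BilinearOperators.

Arguments contBilinOp {R X Y Z} p1 p2 q.
Arguments precompact_bilinear_op {R X Y Z} p1 p2 q.

(* Main.v *)
Require Import Defs.
From HB Require Import structures.
From mathcomp Require Import all_boot all_order all_algebra.
From mathcomp Require Import all_classical all_reals all_analysis.

Set Implicit Arguments.
Unset Strict Implicit.
Unset Printing Implicit Defensive.

Import Order.TTheory GRing.Theory Num.Theory.
Import numFieldNormedType.Exports.

Local Open Scope classical_set_scope.
Local Open Scope ring_scope.

(** Two properties survive the limit for different reasons. Bilinearity passes to pointwise limits,
    one variable at a time, because limits in the normed space [sym_space q] are unique
    ([linear_pointwise_lim]). Total boundedness of the image of the unit balls passes to uniform
    limits, because a finite net for a close approximant is a coarser net for the limit
    ([totally_bounded_image_approx]). In the closedness claim the limit is bilinear by its type, and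
    closeness in [d_s] is uniform closeness on the unit balls. *)

(** The centres of an [e / 2]-net for the image under [g] also form an [e]-net for that under [f],
    by the triangle inequality. Asking for one approximant per [e], not a sequence, lets it serve
    both halves of the theorem. *)
Lemma totally_bounded_image_approx (R : realType) (V : pseudoMetricType R)
    (I : Type) (B : set I) (f : I -> V) :
  (forall e : R, 0 < e -> exists g : I -> V,
     totally_bounded (g @` B) /\ forall x, B x -> ball (g x) e (f x)) ->
  totally_bounded (f @` B).
Proof.
move=> fB e e0; have e20 : 0 < e / 2 by rewrite divr_gt0.
have [g [tbg gf]] := fB _ e20.
have [F finF gF] := tbg _ e20; exists F => // _ [x Bx <-].
have [c Fc cg] := gF _ (ex_intro2 _ _ x Bx erefl).
by exists c => //; rewrite [e]splitr; apply: ball_triangle cg (gf _ Bx).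
Qed.

(** Both sides of the linearity identity are limits of one and the same sequence, and a normed space
    is Hausdorff. *)
Lemma linear_pointwise_lim (R : realType) (U : lmodType R) (V : normedModType R)
    (f_ : nat -> U -> V) (f : U -> V) :
  (forall n, linear (f_ n)) -> (forall x, f_ n x @[n --> \oo] --> f x) ->
  linear f.
Proof.
move=> f_lin f_f a x y.
have f_lim := cvgD (cvgZl_tmp (k := a) (f_f x)) (f_f y).
have f_comb : (fun n => f_ n (a *: x + y)) = (a \*: f_^~ x) \+ f_^~ y.
  by apply/funext => n; exact: f_lin.
apply: (cvg_unique (@norm_hausdorff _ _) (f_f (a *: x + y))).
rewrite f_comb; exact: f_lim.
Qed.

Theorem proposition4p6 (R : realType) (X Y Z : lmodType R)
    (p1 : asymNorm X) (p2 : asymNorm Y) (q : asymNorm Z) :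
  (forall (T_ : nat -> contBilinOp p1 p2 q) (T : X * Y -> Z),
     (forall n, precompact_bilinear_op p1 p2 q (T_ n)) ->
     (forall xy : X * Y,
        (fun n => T_ n xy : sym_space q) @ \oo --> (T xy : sym_space q)) ->
     {uniform unit_balls p1 p2,
        (fun n => (T_ n : X * Y -> sym_space q)) @ \oo -->
        (T : X * Y -> sym_space q)} ->
     precompact_bilinear_op p1 p2 q T) /\
  closed [set S : contBilinOp p1 p2 q | precompact_bilinear_op p1 p2 q S].
Proof.
split=> [T_ T pcT ptT unifT|S clS].
  split; first split=> [y|x].
  - apply: (@linear_pointwise_lim R X (sym_space q)
      (fun n x => T_ n (x, y)) (fun x => T (x, y))) => [n|x].
      exact: (contBilinOp_bilinear (T_ n)).1.
    exact: ptT.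
  - apply: (@linear_pointwise_lim R Y (sym_space q)
      (fun n y => T_ n (x, y)) (fun y => T (x, y))) => [n|y].
      exact: (contBilinOp_bilinear (T_ n)).2.
    exact: ptT.
  apply: (@totally_bounded_image_approx R (sym_space q)) => e e0.
  (* The maps uniformly [e]-close to [T] on the unit balls form a neighbourhood of [T], so some
     [T_ N] is the approximant sought. *)
  have : nbhs (T : {uniform` unit_balls p1 p2 -> sym_space q})
      [set g | forall xy, unit_balls p1 p2 xy ->
         ball (T xy : sym_space q) e (g xy)].
    apply/uniform_nbhs; exists [set xy | ball xy.1 e xy.2]; split=> //.
    exact: entourage_ball (PosNum e0).
  move=> /unifT [N _ /(_ N (leqnn N)) /= TN].
  exists (T_ N); split; first exact: (pcT N).2.
  by move=> xy /TN /ball_sym.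
split; first exact: contBilinOp_bilinear.
apply: (@totally_bounded_image_approx R (sym_space q)) => e e0.
(* The [d_s]-ball of radius [e] around the closure point [S] contains a precompact operator [S']. *)
have [S' [[_ pcS'] SS']] := clS _ (nbhsx_ballx S e e0).
exists S'; split=> // xy xyB; apply: ball_sym.
(* The difference is turned round to match the terms of the supremum [d_s S S'], which is below
   [e]. *)
rewrite -ball_normE /= distrC -lte_fin.
exact: le_lt_trans (d_s_ub S S' xyB) SS'.
Qed.
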